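(* Let $\mu$ be a permuton and $\sigma_n\sim\mathrm{Sample}_n(\mu)$ for each $n\in\mathbb{N}^*$. Let $\beta\in(0,1]$ and $k\in\mathbb{N}^*$ satisfy $\frac1{k+1}<\beta\le\frac1k$. Then the following assertions are equivalent: (i) $\liminf_{n\to\infty}\frac1n\log\mathbf{P}\big(\mathrm{LIS}(\sigma_n)<\beta n\big)=-\infty$; (ii) for all $n\in\mathbb{N}^*$, $\mathbf{P}\big(\mathrm{LIS}(\sigma_n)\ge\beta n\big)=1$; (iii) $\widetilde{\mathrm{LIS}}_k(\mu)=1$.
   Context: $\mathbb{N}^*=\{1,2,\dots\}$. A permuton is a Borel probability measure on $[0,1]^2$ with both marginals uniform on $[0,1]$. Given points $Z_1,\dots,Z_n\in[0,1]^2$ with distinct $x$-coordinates and distinct $y$-coordinates, $\mathrm{Perm}(Z_1,\dots,Z_n)$ is the permutation $\sigma$ of $\{1,\dots,n\}$ with $\sigma(i)=j$ whenever the point with $i$-th lowest $x$-coordinate has $j$-th lowest $y$-coordinate. $\mathrm{Sample}_n(\mu)$ is the law of $\mathrm{Perm}(Z_1,\dots,Z_n)$ for $Z_1,\dots,Z_n$ i.i.d. with law $\mu$ (a.s. well defined). $\mathrm{LIS}(\sigma)$ is the maximal length of an increasing subsequence of the permutation $\sigma$. A subset $A\subset[0,1]^2$ is nondecreasing if $(x_2-x_1)(y_2-y_1)\ge 0$ for all $(x_1,y_1),(x_2,y_2)\in A$, and $k$-nondecreasing if it is a union of $k$ nondecreasing subsets. $\widetilde{\mathrm{LIS}}_k(\mu):=\sup_A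 \mu(A)$ over closed $k$-nondecreasing $A\subset[0,1]^2$. Convention: $\log 0=-\infty$. *)

(* Defs.v *)
From HB Require Import structures.
From mathcomp Require Import all_boot all_order all_fingroup all_algebra.
From mathcomp Require Import all_classical all_reals all_analysis.

Set Implicit Arguments.
Unset Strict Implicit.
Unset Printing Implicit Defensive.

Import Order.TTheory GRing.Theory Num.Theory.
Import numFieldNormedType.Exports.

Local Open Scope classical_set_scope.
Local Open Scope ring_scope.

(* The plane with its product sigma-algebra, which is the Borel one. *)
Notation plane R := (measurableTypeR R * measurableTypeR R)%type.

Definition unit_square (R : realType) : set (R * R) :=
  `[0, 1]%classic `*` `[0, 1]%classic.

(* Borel measures on [0,1]^2 are encoded as Borel measures on the plane that
   are concentrated on [0,1]^2. *)
Definition permuton (R : realType) (mu : probability (plane R) R) : Prop :=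
  [/\ mu (@unit_square R) = 1%E,
      forall B : set (measurableTypeR R), measurable B ->
        pushforward mu fst B = uniform_prob (@ltr01 R) B
    & forall B : set (measurableTypeR R), measurable B ->
        pushforward mu snd B = uniform_prob (@ltr01 R) B].

Section power_probability.
Context d (T : measurableType d) (R : realType).

Definition cons_pair n (x : T * n.-tuple T) : n.+1.-tuple T :=
  [tuple of x.1 :: x.2].

Lemma measurable_cons_pair n : measurable_fun setT (@cons_pair n).
Proof.
exact: (measurable_cons (@measurable_fst _ _ T _) (@measurable_snd _ _ T _)).
Qed.

HB.instance Definition _ n :=
  isMeasurableFun.Build _ _ _ _ (@cons_pair n) (@measurable_cons_pair n).

(* The n-fold product of P: the joint law of n i.i.d. points with law P. *)
Fixpoint power_prob (P : probability T R) n : probability (n.-tuple T) R :=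
  match n return probability (n.-tuple T) R with
  | 0 => dirac [tuple]
  | m.+1 => distribution (P \x power_prob P m)%E (@cons_pair m)
  end.

Lemma power_probE (P : probability T R) n (B : 'I_n -> set T) :
  (forall i, measurable (B i)) ->
  power_prob P n [set z | forall i, B i (tnth z i)] = (\prod_(i < n) P (B i))%E.
Proof.
elim: n B => [|n IH] B mB.
  by rewrite big_ord0 /= diracE mem_set// => -[].
rewrite big_ord_recl -IH //= /distribution /pushforward.
have mC : measurable [set z : n.-tuple T | forall i, B (lift ord0 i) (tnth z i)].
  rewrite [X in measurable X](_ : _ = \bigcap_(i in [set: 'I_n])
    ((fun z : n.-tuple T => tnth z i) @^-1` B (lift ord0 i))).
    apply: fin_bigcap_measurable => // i _.
    rewrite -[X in measurable X]setTI; exact: (@measurable_tnth _ T n i).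
  by apply/seteqP; split => z /= h i; [move=> _; apply: h | apply: h].
rewrite -product_measure1E//; congr (product_measure1 _ _ _).
apply/seteqP; split => -[x z] /=.
  move=> h; split; first exact: h ord0.
  by move=> i; have := h (lift ord0 i); rewrite tnthS.
move=> [Bx Bz] i; case: (unliftP ord0 i) => [j ->|-> //].
by rewrite tnthS; apply: Bz.
Qed.

End power_probability.

(* 0-based rank of the a-th value of f: value i means (i+1)-th lowest. *)
Definition rank (R : realType) n (f : 'I_n -> R) (a : 'I_n) : nat :=
  #|[pred b : 'I_n | f b < f a]|.

(* If both families of coordinates are injective, exactly one s qualifies;
   the value in the other cases is irrelevant. *)
Definition Perm (R : realType) n (z : n.-tuple (plane R)) : 'S_n :=
  odflt 1%g [pick s : 'S_n | [forall a : 'I_n, forall i : 'I_n, forall j : 'I_n,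
    (rank (fun b => (tnth z b).1 : R) a == i) ==>
    (rank (fun b => (tnth z b).2 : R) a == j) ==> (s i == j)]].

Definition Sample (R : realType) n (mu : probability (plane R) R)
    (S : set 'S_n) : \bar R :=
  power_prob mu n (@Perm R n @^-1` S).

(* The finite set 'S_n carries its discrete sigma-algebra. *)
Definition has_law d (Omega : measurableType d) (R : realType)
    (P : probability Omega R) (T : finType) (X : Omega -> T)
    (law : set T -> \bar R) : Prop :=
  forall S : set T, measurable (X @^-1` S) /\ P (X @^-1` S) = law S.

Definition LIS n (s : 'S_n) : nat :=
  \max_(A : {set 'I_n} | [forall i in A, forall j in A,
                             (i < j)%N ==> (s i < s j)%N]) #|A|.

Definition nondecreasing_subset (R : realType) (A : set (R * R)) : Prop :=
  forall p q, A p -> A q -> 0 <= (q.1 - p.1) * (q.2 - p.2).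

Definition k_nondecreasing (R : realType) (k : nat) (A : set (R * R)) : Prop :=
  exists B : 'I_k -> set (R * R),
    (forall i, nondecreasing_subset (B i)) /\ A = \bigcup_(i in setT) B i.

Definition LISk (R : realType) (k : nat) (mu : probability (plane R) R)
    : \bar R :=
  ereal_sup [set mu A | A in
    [set A : set (R * R) |
       [/\ closed A, A `<=` @unit_square R & k_nondecreasing k A]]].

(* Main.v *)
Require Import Defs.
From mathcomp Require Import all_boot all_order all_fingroup all_algebra.
From mathcomp Require Import all_classical all_reals all_analysis.
From mathcomp Require Import measurable_realfun lra.
Import Order.TTheory GRing.Theory Num.Theory.
Import numFieldNormedType.Exports.
Local Open Scope classical_set_scope.
Local Open Scope ring_scope.

(* If a k-nondecreasing closed set carries almost all the mass, the n sample
   points all lie in it with probability arbitrarily close to 1, and then one of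
   its k nondecreasing pieces contains n / k of them.  Conversely, consider the
   support of mu.  If it contains no k + 1 points going strictly to the south-east
   it is k-nondecreasing (Mirsky's theorem), and it has mass 1.  Otherwise such
   k + 1 points have disjoint neighbourhoods, of mass at least a > 0, that are
   still pairwise in decreasing position; with probability at least a ^ n the l-th
   sample point lies in the neighbourhood number l mod k + 1, for all l, and then
   an increasing subsequence stays in a single neighbourhood, so that it has
   length at most n / (k + 1) + 1, which is eventually less than beta n. *)

(** * Chains of points running from north-west to south-east *)

Definition northwest (R : realType) : rel (R * R) :=
  fun p q => (p.1 < q.1) && (q.2 < p.2).

Lemma northwest_trans (R : realType) : transitive (@northwest R).
Proof.
move=> q p r /andP[pq1 pq2] /andP[qr1 qr2].
by rewrite /northwest (lt_trans pq1)// (lt_trans qr2).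
Qed.

Lemma not_northwest_nondecreasing (R : realType) (p q : R * R) :
  ~~ northwest R p q -> ~~ northwest R q p -> 0 <= (q.1 - p.1) * (q.2 - p.2).
Proof.
rewrite /northwest !negb_and -!leNgt => h1 h2.
case: (ltgtP p.1 q.1) h1 h2 => [pq|qp|->] /=; rewrite ?orbF; last by rewrite subrr mul0r.
- by move=> h _; rewrite mulr_ge0// subr_ge0// ltW.
- by move=> _ h; rewrite mulr_le0// subr_le0// ltW.
Qed.

(* Mirsky's theorem for the order [northwest]: peel off the minimal elements. *)
Lemma no_northwest_chain_k_nondecreasing (R : realType) (k : nat) (S : set (R * R)) :
  (forall s : seq (R * R), size s = k.+1 -> sorted (@northwest R) s ->
    exists2 p, p \in s & ~ S p) ->
  k_nondecreasing k S.
Proof.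
elim: k S => [|k IH] S chS.
  exists (fun=> set0); split => [[]//|].
  apply/seteqP; split => [p Sp|p [[]]//].
  by have [|//|q] := chS [:: p]; rewrite ?inE// => /eqP -> /(_ Sp).
pose M := [set p | S p /\ forall q, S q -> ~~ northwest R q p].
have [s szs sts|B [Bnd BE]] := IH (S `\` M).
  case: s szs sts => [//|q0 s] szs sts.
  case: (pselect (exists2 p, p \in q0 :: s & ~ S p)) => [[p ps Sp]|allS].
    by exists p => //; case.
  (* If the head [q0] were not minimal, a point of [S] to its north-west could be put in front of
     the chain, giving a chain in [S] of the forbidden length. *)
  exists q0; rewrite ?mem_head// => -[Sq0 nMq0].
  apply: nMq0; split=> // q Sq; apply/negP => qq0.
  have [||p] := chS (q :: q0 :: s); first by rewrite /= -szs.
    by rewrite /= qq0.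
  rewrite inE => /predU1P[-> //|pin] Sp.
  by apply: allS; exists p.
exists (fun i => if unlift ord0 i is Some j then B j else M); split.
  move=> i; case: unliftP => [j _|_]; first exact: Bnd.
  by move=> p q [Sp Mp] [Sq Mq]; apply: not_northwest_nondecreasing; [exact: Mq|exact: Mp].
apply/seteqP; split => [p Sp|p [i _]].
  case: (pselect (M p)) => Mp; first by exists ord0 => //; rewrite unlift_none.
  have : (S `\` M) p by [].
  by rewrite BE => -[i _ Bp]; exists (lift ord0 i) => //; rewrite liftK.
case: unliftP => [j _ Bp|_ []//].
by have : (S `\` M) p by [rewrite BE; exists j]; case.
Qed.

(** * The permutation of points with distinct coordinates *)

Section Perm_of_generic_points.
Variables (R : realType) (n : nat).

Definition generic_points (z : n.-tuple (plane R)) : Prop :=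
  injective (fun b => (tnth z b).1 : R) /\ injective (fun b => (tnth z b).2 : R).

Lemma rank_lt (f : 'I_n -> R) (a b : 'I_n) : f a < f b -> (rank f a < rank f b)%N.
Proof.
move=> ab; apply/proper_card/properP; split.
  by apply/fintype.subsetP => c; rewrite !inE => ca; apply: lt_trans ca ab.
by exists a; rewrite !inE ?ltxx.
Qed.

Lemma rank_bound (f : 'I_n -> R) (a : 'I_n) : (rank f a < n)%N.
Proof.
rewrite -[X in (_ < X)%N]card_ord; apply/proper_card/properP; split.
  by apply/fintype.subsetP => c.
by exists a; rewrite // !inE ltxx.
Qed.

Definition rank_ord (f : 'I_n -> R) (a : 'I_n) : 'I_n := Ordinal (rank_bound f a).

Lemma rank_ltE (f : 'I_n -> R) : injective f ->
  forall a b, (rank_ord f a < rank_ord f b)%N = (f a < f b).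
Proof.
move=> finj a b /=; case: (ltgtP (f a) (f b)) => [|/rank_lt|/finj ->]; first exact: rank_lt.
- by move=> ba; rewrite ltnNge (ltnW ba).
- by rewrite ltnn.
Qed.

Lemma rank_ord_inj (f : 'I_n -> R) : injective f -> injective (rank_ord f).
Proof.
move=> finj a b ab; apply: finj.
by case: (ltgtP (f a) (f b)) => // /rank_lt;
  rewrite -[rank f a]/(nat_of_ord (rank_ord f a)) ab ltnn.
Qed.

(** The permutation [s1^-1 * s2], which takes x-ranks to y-ranks, satisfies the test in [Perm];
    hence the default value is not returned, and whatever is picked passes the test at [a]. *)
Lemma Perm_rank (z : n.-tuple (plane R)) : generic_points z ->
  forall a, Defs.Perm z (rank_ord (fun b => (tnth z b).1 : R) a) =
            rank_ord (fun b => (tnth z b).2 : R) a.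
Proof.
move=> [inj1 inj2] a.
set f1 := fun b => _ in inj1 *; set f2 := fun b => _ in inj2 *.
rewrite /Defs.Perm; case: pickP => [s|no_s].
  move=> /forallP/(_ a)/forallP/(_ (rank_ord f1 a))/forallP/(_ (rank_ord f2 a)).
  by rewrite !eqxx /= => /eqP.
pose s1 := perm (rank_ord_inj _ inj1); pose s2 := perm (rank_ord_inj _ inj2).
have /negP[] := negbT (no_s (s1^-1 * s2)%g).
apply/forallP => b; apply/forallP => i; apply/forallP => j.
apply/implyP => /eqP bi; apply/implyP => /eqP bj.
have -> : i = s1 b by apply: val_inj; rewrite /= permE -bi.
have -> : j = s2 b by apply: val_inj; rewrite /= permE -bj.
by rewrite permM permK.
Qed.

(** The x-ranks of the points indexed by [A] are the positions of an increasing subsequence: the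
    weak inequality between y-coordinates is strict because these are distinct. *)
Lemma LIS_Perm_ge (z : n.-tuple (plane R)) (A : {set 'I_n}) : generic_points z ->
  nondecreasing_subset [set p : R * R | exists2 a, a \in A & p = tnth z a] ->
  (#|A| <= LIS (Defs.Perm z))%N.
Proof.
move=> gz ndA; have [inj1 inj2] := gz.
set f1 := fun b => _ in inj1; set f2 := fun b => _ in inj2.
rewrite -(card_imset A (rank_ord_inj _ inj1)).
apply: (@leq_bigmax_cond _ _ (fun A : {set 'I_n} => #|A|)).
apply/forall_inP => _ /imsetP[a aA ->]; apply/forall_inP => _ /imsetP[b bA ->].
rewrite !Perm_rank// !rank_ltE//; apply/implyP => ab.
have := ndA (tnth z a) (tnth z b) (ex_intro2 _ _ a aA erefl) (ex_intro2 _ _ b bA erefl).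
rewrite pmulr_rge0 ?subr_gt0// subr_ge0 le_eqVlt => /predU1P[/inj2 eab|//].
by rewrite /f1 eab ltxx in ab.
Qed.

(** A longest increasing subsequence is a set of positions; its preimage under the bijective x-rank
    is a set of sample indices of the same size. *)
Lemma LIS_Perm_attained (z : n.-tuple (plane R)) : generic_points z ->
  exists A : {set 'I_n}, #|A| = LIS (Defs.Perm z) /\
    forall a b, a \in A -> b \in A -> ~~ northwest R (tnth z a) (tnth z b).
Proof.
move=> gz; have [inj1 inj2] := gz.
set f1 := fun b => _ in inj1; set f2 := fun b => _ in inj2.
(* The empty set is admissible, so the maximum defining [LIS] is attained. *)
have P0 : [forall i in (finset.set0 : {set 'I_n}), forall j in (finset.set0 : {set 'I_n}),
    (i < j)%N ==> (Defs.Perm z i < Defs.Perm z j)%N].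
  by apply/forall_inP => i; rewrite inE.
rewrite /LIS (@bigop.bigmax_eq_arg _ finset.set0)//; case: arg_maxnP => // B incB _.
exists (rank_ord f1 @^-1: B); split.
  by apply: on_card_preimset; apply: onW_bij; apply: injF_bij; exact: rank_ord_inj.
move=> a b; rewrite !inE => aB bB; apply/negP => /andP[ab1 ab2].
move: incB => /forall_inP/(_ _ aB)/forall_inP/(_ _ bB)/implyP.
by rewrite !Perm_rank// !rank_ltE// => /(_ ab1) /(lt_trans ab2); rewrite ltxx.
Qed.

End Perm_of_generic_points.

(** * Countable unions of null sets, and measurability of [Perm] *)

Lemma negligible_bigcup_countType d (T : measurableType d) (R : realType)
    (mu : {measure set T -> \bar R}) (I : countType) (D : set I) (F : I -> set T) :
  (forall i, D i -> mu.-negligible (F i)) -> mu.-negligible (\bigcup_(i in D) F i).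
Proof.
move=> negF.
pose G n := if unpickle n is Some i then if i \in D then F i else set0 else set0.
suff : mu.-negligible (\bigcup_n G n).
  apply: negligibleS => x [i Di Fix].
  by exists (pickle i) => //; rewrite /G pickleK mem_set.
apply: negligible_bigcup => n; rewrite /G.
case: unpickle => [i|]; last exact: negligible_set0.
by case: ifP => [/set_mem/negF//|_]; exact: negligible_set0.
Qed.

Section Perm_measurable.
Variables (R : realType) (n : nat).

Let comparisons (z : n.-tuple (plane R)) : {ffun 'I_n * 'I_n -> bool * bool} :=
  [ffun ab => (((tnth z ab.1).1 : R) < (tnth z ab.2).1,
               ((tnth z ab.1).2 : R) < (tnth z ab.2).2)].

Lemma Perm_comparisons (z z' : n.-tuple (plane R)) :
  comparisons z = comparisons z' -> Defs.Perm z = Defs.Perm z'.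
Proof.
move=> zz'; have cmp a b := congr1 (fun h : {ffun _} => h (a, b)) zz'.
have r1 a : rank (fun b => (tnth z b).1 : R) a = rank (fun b => (tnth z' b).1 : R) a.
  by apply: eq_card => b; have := cmp b a; rewrite !inE !ffunE => -[].
have r2 a : rank (fun b => (tnth z b).2 : R) a = rank (fun b => (tnth z' b).2 : R) a.
  by apply: eq_card => b; have := cmp b a; rewrite !inE !ffunE => -[].
rewrite /Defs.Perm; congr odflt; apply: eq_pick => s; apply: eq_forallb => a.
by rewrite r1 r2.
Qed.

(** [Perm] factors through [comparisons], which has finitely many values; each fibre is a finite
    intersection of events comparing two coordinates. *)
Lemma measurable_Perm (S : set 'S_n) : measurable (@Defs.Perm R n @^-1` S).
Proof.
have -> : @Defs.Perm R n @^-1` S =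
    \bigcup_(m in comparisons @` (@Defs.Perm R n @^-1` S)) comparisons @^-1` [set m].
  apply/seteqP; split => [z Sz|z [_ [z' Sz' <-]] /= /Perm_comparisons].
    by exists (comparisons z) => //; exists z.
  by move=> ->.
apply: fin_bigcup_measurable => [|m _]; first exact: finite_finset.
have -> : comparisons @^-1` [set m] = \bigcap_(ab in [set: 'I_n * 'I_n])
    ([set z | (((tnth z ab.1).1 : R) < (tnth z ab.2).1) = (m ab).1] `&`
     [set z | (((tnth z ab.1).2 : R) < (tnth z ab.2).2) = (m ab).2]).
  apply/seteqP; split => [z <- ab _|z h] /=; first by rewrite ffunE.
  by apply/ffunP => ab; rewrite ffunE; case: (h ab) => //= -> ->; case: (m ab).
apply: fin_bigcap_measurable => [|ab _]; first exact: finite_finset.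
have mfst i : measurable_fun setT (fun z : n.-tuple (plane R) => (tnth z i).1).
  exact: (measurableT_comp measurable_fst (measurable_tnth i)).
have msnd i : measurable_fun setT (fun z : n.-tuple (plane R) => (tnth z i).2).
  exact: (measurableT_comp measurable_snd (measurable_tnth i)).
apply: measurableI; rewrite -[X in measurable X]setTI.
- exact: (measurable_fun_ltr (mfst ab.1) (mfst ab.2) measurableT (Y := [set (m ab).1])).
- exact: (measurable_fun_ltr (msnd ab.1) (msnd ab.2) measurableT (Y := [set (m ab).2])).
Qed.

End Perm_measurable.

(** * Almost sure distinctness of the coordinates of a sample *)

Section almost_surely_distinct.
Context d (T : measurableType d) (R : realType) (P : probability T R).
Variable f : T -> measurableTypeR R.
Hypotheses (mf : measurable_fun setT f) (Pf0 : forall c, P (f @^-1` [set c]) = 0%E).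

Lemma measurable_level (c : R) : measurable (f @^-1` [set c]).
Proof. by rewrite -[X in measurable X]setTI; apply: mf => //; exact: measurable_set1. Qed.

Lemma power_prob_level n (j : 'I_n) (c : R) :
  power_prob P n [set z | f (tnth z j) = c] = 0%E.
Proof.
pose B i := if i == j then f @^-1` [set c] else setT.
have -> : [set z | f (tnth z j) = c] = [set z : n.-tuple T | forall i, B i (tnth z i)].
  apply/seteqP; split => z /=; last by move=> /(_ j); rewrite /B eqxx.
  by move=> zj i; rewrite /B; case: eqP => // ->.
rewrite power_probE => [|i]; last first.
  by rewrite /B; case: ifP => // _; exact: measurable_level.
by rewrite (bigD1 j)//= /B eqxx Pf0 mul0e.
Qed.

Lemma measurable_coincidence n (i j : 'I_n) :
  measurable [set z : n.-tuple T | f (tnth z i) = f (tnth z j)].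
Proof.
have mfi (l : 'I_n) : measurable_fun setT (fun z : n.-tuple T => f (tnth z l)).
  exact: (measurableT_comp mf (measurable_tnth l)).
have := measurable_fun_eqr (mfi i) (mfi j) measurableT (Y := [set true]) I.
rewrite setTI; congr measurable; apply/seteqP; split => z /= /eqP //.
Qed.

(** Induction on [n]. If one index is the first, Fubini applies: once the first point is fixed,
    another point must lie on a given level of [f], a null event. Otherwise the event concerns only
    the tail. *)
Lemma power_prob_coincidence n (i j : 'I_n) : i != j ->
  power_prob P n [set z | f (tnth z i) = f (tnth z j)] = 0%E.
Proof.
elim: n i j => [[]//|n IH] i j.
have head_tail (l : 'I_n) :
    power_prob P n.+1 [set z | f (tnth z ord0) = f (tnth z (lift ord0 l))] = 0%E.
  rewrite /= /distribution /pushforward.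
  apply: integral0_eq => x _ /=.
  rewrite -[RHS](power_prob_level n l (f x)); congr (power_prob P n _).
  apply/seteqP; split => z; rewrite /xsection /= inE /= tnthS.
    by rewrite (tnth_nth x).
  by move=> ->; rewrite (tnth_nth x).
case: (unliftP ord0 i) => [i' ->|->];
  case: (unliftP ord0 j) => [j' ->|->]; last by rewrite eqxx.
- rewrite (inj_eq lift_inj) => ij'.
  rewrite /= /distribution /pushforward.
  rewrite [X in product_measure1 _ _ X](_ : _ =
      setT `*` [set z | f (tnth z i') = f (tnth z j')]); last first.
    by apply/seteqP; split => -[x z] /=; rewrite !tnthS; [split|case].
  apply: etrans (product_measure1E _ _ measurableT (measurable_coincidence n i' j')) _.
  exact: etrans (congr1 (mule _) (IH i' j' ij')) (mule0 _).
- by move=> _; rewrite -(head_tail i'); congr (power_prob P _ _);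
  apply/seteqP; split => z /= ->.
- by move=> _; exact: head_tail.
Qed.

Lemma power_prob_not_injective n :
  (power_prob P n).-negligible [set z | ~ injective (fun i => f (tnth z i))].
Proof.
have neglU : (power_prob P n).-negligible
    (\bigcup_(ij in [set ij : 'I_n * 'I_n | ij.1 != ij.2])
    [set z | f (tnth z ij.1) = f (tnth z ij.2)]).
  apply: negligible_bigcup_countType => ij neq.
  apply/negligibleP; first exact: measurable_coincidence.
  exact: power_prob_coincidence.
apply: negligibleS neglU => z /= zni.
have [i [j [fij ij]]] : exists i j, f (tnth z i) = f (tnth z j) /\ i != j.
  apply: contrapT => no; apply: zni => i j fij; apply/eqP; rewrite -[_ == _]negbK.
  by apply/negP => ij; apply: no; exists i, j.
by exists (i, j).
Qed.

End almost_surely_distinct.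

(** * Borel sets of the plane and the support of [mu] *)

Section rational_boxes.
Variable R : realType.

(** A countable base of the plane: it makes open sets measurable for the product sigma-algebra, and
    unions of null boxes null. *)
Definition rat_box (q : rat * rat * (rat * rat)) : set (R * R) :=
  `]ratr q.1.1, ratr q.1.2[%classic `*` `]ratr q.2.1, ratr q.2.2[%classic.

Definition square_ball (p : R * R) (e : R) : set (R * R) :=
  `]p.1 - e, p.1 + e[%classic `*` `]p.2 - e, p.2 + e[%classic.

Lemma measurable_square_ball (p : R * R) (e : R) :
  measurable (square_ball p e : set (plane R)).
Proof. by apply: measurableX; exact: measurable_itv. Qed.

Lemma measurable_rat_box q : measurable (rat_box q : set (plane R)).
Proof. by apply: measurableX; exact: measurable_itv. Qed.

Lemma open_rat_box q : open (rat_box q).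
Proof.
have -> : rat_box q =
    fst @^-1` `]ratr q.1.1, ratr q.1.2[ `&` snd @^-1` `]ratr q.2.1, ratr q.2.2[.
  by [].
apply: openI; apply: open_comp; try exact: itv_open.
- by move=> x _; exact: cvg_fst.
- by move=> x _; exact: cvg_snd.
Qed.

Lemma rat_box_in_square_ball (p : R * R) (e : R) : 0 < e ->
  exists q, rat_box q p /\ rat_box q `<=` square_ball p e.
Proof.
move=> e0.
have around (x : R) : exists a b : rat, x - e < ratr a < x /\ x < ratr b < x + e.
  have [a] := @rat_in_itvoo R (x - e) x ltac:(lra).
  have [b] := @rat_in_itvoo R x (x + e) ltac:(lra).
  by rewrite !in_itv/=; exists a, b.
have [a [b [/andP[a1 a2] /andP[b1 b2]]]] := around p.1.
have [c [d [/andP[c1 c2] /andP[d1 d2]]]] := around p.2.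
exists ((a, b), (c, d)); split.
  by split => /=; rewrite in_itv/=; apply/andP.
move=> r [] /=; rewrite !in_itv/= => /andP[? ?] /andP[? ?].
by split => /=; rewrite in_itv/=; apply/andP; split; lra.
Qed.

Lemma open_bigcup_rat_box (U : set (R * R)) : open U ->
  U = \bigcup_(q in [set q | rat_box q `<=` U]) rat_box q.
Proof.
move=> oU; apply/seteqP; split => [p Up|p [q /= qU qp]]; last exact: qU.
have /nbhs_ballP[e /= e0 pU] : nbhs p U by exact: open_nbhs_nbhs.
have [q [qp qe]] := rat_box_in_square_ball p e e0.
exists q => //= r /qe [/=]; rewrite !in_itv/= => /andP[? ?] /andP[? ?]; apply: pU.
by split; rewrite -ball_normE /= ltr_norml; apply/andP; split; lra.
Qed.

Lemma open_plane_measurable (U : set (R * R)) : open U -> measurable (U : set (plane R)).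
Proof.
move=> /open_bigcup_rat_box ->; rewrite bigcup_mkcond.
apply: countable_bigcupT_measurable => // q.
by case: ifP => // _; exact: measurable_rat_box.
Qed.

Lemma closed_plane_measurable (A : set (R * R)) : closed A -> measurable (A : set (plane R)).
Proof.
move=> cA; rewrite -[A]setCK; apply: measurableC.
by apply: open_plane_measurable; exact: closed_openC.
Qed.

Lemma closed_unit_square : closed (@unit_square R).
Proof.
have -> : @unit_square R = fst @^-1` `[0, 1] `&` snd @^-1` `[0, 1] by [].
apply: closedI; apply: closed_comp; try exact: itv_closed.
- by move=> x _; exact: cvg_fst.
- by move=> x _; exact: cvg_snd.
Qed.

Variable mu : probability (plane R) R.
Hypothesis mu_square : mu (@unit_square R) = 1%E.

(** The topological support of a measure concentrated on the square; null boxes of a countable base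
    suffice to describe it. *)
Definition plane_support : set (R * R) :=
  @unit_square R `\` \bigcup_(q in [set q | mu (rat_box q) = 0%E]) rat_box q.

Lemma closed_plane_support : closed plane_support.
Proof.
apply: closedI; first exact: closed_unit_square.
by apply: open_closedC; apply: bigcup_open => q _; exact: open_rat_box.
Qed.

(** The complement consists of the outside of the square and of countably many null boxes. *)
Lemma mu_plane_support : mu plane_support = 1%E.
Proof.
have msq := closed_plane_measurable _ closed_unit_square.
have /negligibleP : mu.-negligible (~` plane_support).
  rewrite /plane_support setCD; apply: negligibleU; last first.
    apply: negligible_bigcup_countType => q /= q0; apply/negligibleP => //.
    exact: measurable_rat_box.
  apply/negligibleP; first exact: measurableC.
  by have := probability_setC mu msq; rewrite mu_square subee.
have mS := closed_plane_measurable _ closed_plane_support.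
move=> /(_ (measurableC mS)) supp0.
have := probability_setC mu (measurableC mS).
by rewrite setCK supp0 sube0.
Qed.

(** The ball contains a rational box around [p], which is not among the null boxes that were
    removed. *)
Lemma mu_square_ball_gt0 (p : R * R) (e : R) : plane_support p -> 0 < e ->
  (0 < mu (square_ball p e))%E.
Proof.
move=> [_ pnull] /(rat_box_in_square_ball p)[q [qp qe]].
apply: (@lt_le_trans _ _ (mu (rat_box q))).
  by rewrite lt0e measure_ge0 andbT; apply/eqP => q0; apply: pnull; exists q.
by apply: le_measure; rewrite ?inE//; [exact: measurable_rat_box|exact: measurable_square_ball].
Qed.

End rational_boxes.

(** * From sample points to their permutation *)

Lemma permuton_generic (R : realType) (mu : probability (plane R) R) (n : nat) :
  permuton mu -> (power_prob mu n).-negligible [set z | ~ generic_points R n z].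
Proof.
move=> [_ mu1 mu2].
(* The uniform law is absolutely continuous, hence has no atoms. *)
have uni0 (c : R) : uniform_prob (@ltr01 R) [set c] = 0%E.
  have /null_content_dominatesP uni_leb := dominates_uniform_prob (@ltr01 R).
  by apply: uni_leb; [exact: measurable_set1|exact: lebesgue_measure_set1].
have N1 := power_prob_not_injective _ _ _ mu fst measurable_fst
  (fun c => etrans (mu1 _ (measurable_set1 c)) (uni0 c)) n.
have N2 := power_prob_not_injective _ _ _ mu snd measurable_snd
  (fun c => etrans (mu2 _ (measurable_set1 c)) (uni0 c)) n.
apply: negligibleS (negligibleU N1 N2) => z /not_andP[]; [by left|by right].
Qed.

(** The part of [E] where [S] fails contains no generic sample, so it is null. *)
Lemma Sample_ge (R : realType) (mu : probability (plane R) R) (n : nat)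
    (E : set (n.-tuple (plane R))) (S : set 'S_n) : permuton mu -> measurable E ->
    (forall z, generic_points R n z -> E z -> S (Defs.Perm z)) ->
  (power_prob mu n E <= Sample mu S)%E.
Proof.
move=> pmu mE ES; have mS := measurable_Perm R n S.
have E0 : power_prob mu n (E `\` @Defs.Perm R n @^-1` S) = 0%E.
  apply/negligibleP; first exact: measurableD.
  apply: negligibleS (permuton_generic _ _ n pmu) => z [Ez nSz] gz.
  by apply: nSz; exact: ES.
have -> : power_prob mu n E = power_prob mu n (E `&` @Defs.Perm R n @^-1` S).
  apply: etrans (measureDI (power_prob mu n) mE mS) _.
  exact: etrans (congr1 (adde^~ _) E0) (add0e _).
by apply: le_measure; rewrite ?inE//; exact: measurableI.
Qed.

Lemma LIS_k_nondecreasing (R : realType) (n k : nat) (A : set (R * R))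
    (z : n.-tuple (plane R)) : k_nondecreasing k A -> generic_points R n z ->
  (forall i, A (tnth z i)) -> (n <= k * LIS (Defs.Perm z))%N.
Proof.
move=> [B [ndB AB]] gz Az.
have [c Bc] : {c : 'I_n -> 'I_k & forall i, B (c i) (tnth z i)}.
  apply: (@choice _ _ (fun i j => B j (tnth z i))) => i.
  by have := Az i; rewrite AB => -[j _]; exists j.
(* Pigeonhole: the [n] indices split into [k] classes according to the chosen piece, and each class
   has at most [LIS] elements. *)
rewrite -[n in leqLHS]card_ord -sum1_card (partition_big c xpredT)//=.
rewrite -[k in leqRHS]card_ord -sum_nat_const; apply: leq_sum => j _.
rewrite sum1_card -(cardsE [pred i | c i == j]);
apply: LIS_Perm_ge => // _ _ [a + ->] [b + ->].
by rewrite !inE => /eqP <- /eqP bj; apply: (ndB (c a)); [exact: Bc|rewrite -bj; exact: Bc].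
Qed.

(** Indices of an increasing subsequence share one residue modulo [m], hence are told apart by their
    quotients, which lie between 0 and [n %/ m]. *)
Lemma LIS_northwest_blocks (R : realType) (n m : nat) (z : n.-tuple (plane R)) :
  (0 < m)%N -> generic_points R n z ->
  (forall a b : 'I_n, (a %% m < b %% m)%N -> northwest R (tnth z a) (tnth z b)) ->
  (LIS (Defs.Perm z) <= (n %/ m).+1)%N.
Proof.
move=> m0 gz nwz; have [A [<- nnwA]] := LIS_Perm_attained R n z gz.
pose g (a : 'I_n) : 'I_(n %/ m).+1 := inord (a %/ m).
rewrite -[leqRHS]card_ord -(@card_in_imset _ _ g); first exact: max_card.
move=> a b aA bA /(congr1 val).
rewrite /g /= !inordK ?ltnS ?leq_div2r ?(ltnW (ltn_ord _))// => divab.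
apply: val_inj; rewrite /= (divn_eq a m) (divn_eq b m) divab; congr addn.
by case: (ltngtP (a %% m) (b %% m)) => // /nwz; rewrite (negbTE (nnwA _ _ _ _)).
Qed.

(** * Bernoulli's inequality and lower bounds for sampling probabilities *)

Lemma exprB_ge (R : realType) (e : R) (n : nat) : 0 <= e <= 1 ->
  1 - n%:R * e <= (1 - e) ^+ n.
Proof.
move=> /andP[e0 e1]; elim: n => [|n IH]; first by rewrite mul0r subr0 expr0.
rewrite exprS; apply: (le_trans (y := (1 - e) * (1 - n%:R * e))).
  have : 0 <= n%:R * e * e by rewrite !mulr_ge0.
  by rewrite -natr1; lra.
by rewrite ler_wpM2l// subr_ge0.
Qed.

Lemma power_prob_ge d (T : measurableType d) (R : realType) (P : probability T R)
    (n : nat) (B : 'I_n -> set T) (a : R) : (forall i, measurable (B i)) -> 0 <= a ->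
    (forall i, (a%:E <= P (B i))%E) ->
  ((a ^+ n)%:E <= power_prob P n [set z | forall i, B i (tnth z i)])%E.
Proof.
move=> mB a0 aB; rewrite power_probE//.
have -> : (a ^+ n)%:E = (\prod_(i < n) a%:E)%E.
  by elim: n {B mB aB} => [|n IH]; rewrite ?big_ord0 ?expr0// big_ord_recl exprS EFinM IH.
elim: n B mB aB => [|n IH] B mB aB; first by rewrite !big_ord0.
rewrite !big_ord_recl; apply: lee_pmul; rewrite ?lee_fin//.
- by apply: prode_ge0 => i _; rewrite lee_fin.
- by apply: IH => i.
Qed.

Lemma measurable_forall_tnth d (T : measurableType d) (n : nat) (B : 'I_n -> set T) :
  (forall i, measurable (B i)) -> measurable [set z : n.-tuple T | forall i, B i (tnth z i)].
Proof.
move=> mB.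
have -> : [set z : n.-tuple T | forall i, B i (tnth z i)] =
    \bigcap_(i in [set: 'I_n]) ((fun z => tnth z i) @^-1` B i).
  by apply/seteqP; split => z /= h i; [move=> _; exact: h|exact: h].
apply: fin_bigcap_measurable => [|i _]; first exact: finite_finset.
by rewrite -[X in measurable X]setTI; exact: measurable_tnth.
Qed.

Lemma Sample_le1 (R : realType) (mu : probability (plane R) R) n (S : set 'S_n) :
  (Sample mu S <= 1)%E.
Proof. by rewrite /Sample; apply: probability_le1; exact: measurable_Perm. Qed.

(** The supremum is only approached here: a closed set of mass more than [1 - e'] contains all [n]
    points with probability at least [(1 - e') ^+ n]. *)
Lemma Sample_LISk_eq1 (R : realType) (mu : probability (plane R) R) (n k : nat) :
  permuton mu -> LISk k mu = 1%E ->
  Sample mu [set s : 'S_n | (n <= k * LIS s)%N] = 1%E.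
Proof.
move=> pmu LIS1; apply/eqP; rewrite eq_le Sample_le1/=; apply/lee_addgt0Pr => e e0.
(* Chosen so that [n%:R * e' <= e], whence Bernoulli gives [1 - e <= (1 - e') ^+ n]; the successor
   avoids dividing by 0. *)
pose e' := Num.min 1 (e / n.+1%:R).
have e'0 : 0 < e' by rewrite lt_min ltr01 divr_gt0.
have e'1 : e' <= 1 by rewrite ge_min lexx.
have : ((1 - e')%:E < LISk k mu)%E by rewrite LIS1 lte_fin; lra.
move=> /ereal_sup_gt[_ [A [cA _ kA] <-]] eA.
have mA := closed_plane_measurable R A cA.
have geA := Sample_ge R mu n [set z | forall i, A (tnth z i)]
  [set s : 'S_n | (n <= k * LIS s)%N] pmu (measurable_forall_tnth _ _ n (fun=> A) (fun=> mA))
  (fun z gz Az => LIS_k_nondecreasing R n k A z kA gz Az).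
apply: (@le_trans _ _ ((1 - e') ^+ n + e)%:E).
  rewrite lee_fin -lerBlDr; apply: le_trans (exprB_ge R e' n _); last lra.
  rewrite lerD2l lerN2 (le_trans (y := n%:R * (e / n.+1%:R)))//.
    by rewrite ler_wpM2l// ge_min lexx orbT.
  by rewrite mulrCA ger_pMr// ler_pdivrMr// mul1r ler_nat.
rewrite EFinD leeD2r//; apply: le_trans geA.
by apply: (power_prob_ge _ _ _ mu n (fun=> A)) => //; [lra|move=> _; exact: ltW].
Qed.

Lemma finite_lower_bound (R : realType) (I : finType) (f : I -> R) :
  (forall i, 0 < f i) -> exists2 e, 0 < e & forall i, e <= f i.
Proof.
move=> f0; exists (\big[Num.min/1]_i f i); first by apply: lt_bigmin.
by move=> i; exact: bigmin_le.
Qed.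

Lemma Sample_LIS_chain (R : realType) (mu : probability (plane R) R) (m : nat)
    (s : seq (R * R)) : permuton mu -> (0 < m)%N ->
    size s = m -> sorted (northwest R) s -> (forall p, p \in s -> plane_support R mu p) ->
  exists2 a : R, 0 < a & forall n,
    ((a ^+ n)%:E <= Sample mu [set s : 'S_n | (LIS s <= (n %/ m).+1)%N])%E.
Proof.
move=> pmu m0 sz srt supp_s; pose p (i : nat) := nth 0 s i.
have nwp (i j : 'I_m) : (i < j)%N -> northwest R (p i) (p j).
  by move=> ij; apply: (sorted_ltn_nth (northwest_trans R)) => //; rewrite inE sz.
(* With half-side at most half of each coordinate gap, the open squares around two chain points keep
   their strict relative position. The value 1 is a harmless filler for the other pairs. *)
pose gap (ij : 'I_m * 'I_m) : R := if (ij.1 < ij.2)%N then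
  Num.min ((p ij.2).1 - (p ij.1).1) ((p ij.1).2 - (p ij.2).2) / 2 else 1.
have [|e e0 e_gap] := finite_lower_bound R _ gap.
  move=> [i j]; rewrite /gap /=; case: ifP => // /nwp/andP[? ?].
  by rewrite divr_gt0// lt_min !subr_gt0; apply/andP.
have nw_ball (i j : 'I_m) q r : (i < j)%N ->
    square_ball R (p i) e q -> square_ball R (p j) e r -> northwest R q r.
  move=> ij; have := e_gap (i, j); rewrite /gap /= ij ler_pdivlMr// le_min => /andP[g1 g2].
  case=> /=; rewrite !in_itv/= => /andP[? ?] /andP[? ?] [/=].
  by rewrite !in_itv/= => /andP[? ?] /andP[? ?]; apply/andP; split; lra.
have fin_ball i : mu (square_ball R (p i) e) \is a fin_num.
  by apply: fin_num_measure; exact: measurable_square_ball.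
(* The constant [a] bounds from below the masses of the [m] squares, all positive since their
   centres lie in the support. *)
have [|a a0 a_le] := finite_lower_bound R 'I_m
  (fun i => fine (mu (square_ball R (p i) e))).
  move=> i; rewrite -lte_fin fineK//; apply: mu_square_ball_gt0 => //.
  by apply: supp_s; rewrite mem_nth// sz.
exists a => // n; pose B (l : 'I_n) := square_ball R (p (l %% m)%N) e.
have mB l : measurable (B l : set (plane R)) by exact: measurable_square_ball.
have LISB z : generic_points R n z -> (forall l, B l (tnth z l)) ->
    (LIS (Defs.Perm z) <= (n %/ m).+1)%N.
  move=> gz Bz; apply: (LIS_northwest_blocks R) => // b c bc.
  exact: (nw_ball (Ordinal (ltn_pmod b m0)) (Ordinal (ltn_pmod c m0)) _ _ bc (Bz b) (Bz c)).
apply: le_trans (Sample_ge R mu n _ [set s : 'S_n | (LIS s <= (n %/ m).+1)%N] pmu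
  (measurable_forall_tnth _ _ n B mB) LISB).
apply: (power_prob_ge _ _ _ mu n B) => // [|l]; first exact: ltW.
rewrite -[leRHS](fineK (fin_ball _)) lee_fin.
exact: (a_le (Ordinal (ltn_pmod l m0))).
Qed.

Lemma LISk_eq1 (R : realType) (mu : probability (plane R) R) (k : nat) (A : set (R * R)) :
  closed A -> A `<=` @unit_square R -> k_nondecreasing k A -> mu A = 1%E ->
  LISk k mu = 1%E.
Proof.
move=> cA sqA kA muA; apply/eqP; rewrite eq_le; apply/andP; split.
  apply: ge_ereal_sup => _ [C [cC _ _] <-].
  by apply: probability_le1; exact: closed_plane_measurable.
by rewrite -muA; apply: ereal_sup_ubound; exists A.
Qed.

(** * Lower bounds on logarithmic rates *)

Lemma limn_einf_ge (R : realType) (u : (\bar R)^nat) (l : \bar R) (N : nat) :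
  (forall n, (N <= n)%N -> (l <= u n)%E) -> (l <= limn_einf u)%E.
Proof.
move=> lu; rewrite limn_einf_lim; apply: lime_ge; first exact: is_cvg_einfs.
near=> n; apply: le_ereal_inf_tmp => _ [i /= ni <-]; apply: lu.
by apply: leq_trans ni; near: n; exact: nbhs_infty_ge.
Unshelve. all: by end_near. Qed.

Lemma lne_power_rate (R : realType) (a : R) (n : nat) (x : \bar R) : (0 < n)%N ->
  0 < a -> ((a ^+ n)%:E <= x)%E -> ((ln a)%:E <= (n%:R^-1)%:E * lne x)%E.
Proof.
move=> n0 a0 ax.
have -> : (ln a)%:E = ((n%:R^-1)%:E * lne (a ^+ n)%:E)%E.
  rewrite lne_EFin ?exprn_gt0// lnXn// -EFinM -[ln a *+ n]mulr_natl mulKf//.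
  by rewrite pnatr_eq0 -lt0n.
rewrite lee_pmul2l ?lte_fin ?invr_gt0 ?ltr0n//.
have an0 : (0 <= (a ^+ n)%:E)%E by rewrite lee_fin exprn_ge0// ltW.
by rewrite lee_lne// in_itv/= leey andbT// (le_trans an0).
Qed.

Theorem theorem2p7 (R : realType) (mu : probability (plane R) R)
  (hmu : permuton mu)
  (d : nat -> measure_display)
  (Omega : forall n : nat, measurableType (d n))
  (P : forall n : nat, probability (Omega n) R)
  (sigma : forall n : nat, Omega n -> 'S_n)
  (hsigma : forall n : nat, (0 < n)%N -> has_law (P n) (sigma n) (Sample mu))
  (beta : R) (k : nat)
  (hbeta : 0 < beta <= 1) (hk : (0 < k)%N)
  (hbk : k.+1%:R^-1 < beta <= k%:R^-1) :
  let assertion_i :=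
    limn_einf (fun n : nat => (n%:R^-1)%:E *
      lne (P n [set w | ((LIS (sigma n w))%:R < beta * n%:R)%R]))%E = -oo%E in
  let assertion_ii :=
    forall n : nat, (0 < n)%N ->
      P n [set w | beta * n%:R <= (LIS (sigma n w))%:R] = 1%E in
  let assertion_iii := LISk k mu = 1%E in
  (assertion_i <-> assertion_ii) /\ (assertion_ii <-> assertion_iii).

Proof.
move=> assertion_i assertion_ii assertion_iii.
have P_law n (S : set 'S_n) : (0 < n)%N -> P n (sigma n @^-1` S) = Sample mu S.
  by move=> n0; have [] := hsigma n n0 S.
have [bk1 bk2] := andP hbk.
have ii_i : assertion_ii -> assertion_i.
  (* For positive [n] the event is the complement of an almost sure one, so its logarithm, and with
     it the whole term, is [-oo]. *)
  move=> ii; apply: (cvgNy_limn_einf_sup _).1; apply/cvgeNyPle => M.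
  near=> n; have n0 : (0 < n)%N by near: n; exact: nbhs_infty_gt.
  have [mS _] := hsigma n n0 [set s : 'S_n | beta * n%:R <= (LIS s)%:R].
  have -> : [set w | (LIS (sigma n w))%:R < beta * n%:R] =
      ~` (sigma n @^-1` [set s : 'S_n | beta * n%:R <= (LIS s)%:R]).
    by apply/seteqP; split => w /=; rewrite ltNge => /negP.
  rewrite probability_setC// [P n _](ii n n0) subee// le0_lneNy//.
  by rewrite gt0_muleNy ?leNye// lte_fin invr_gt0 ltr0n.
have iii_ii : assertion_iii -> assertion_ii.
  move=> iii n n0; rewrite (P_law n [set s : 'S_n | beta * n%:R <= (LIS s)%:R] n0).
  apply/eqP; rewrite eq_le Sample_le1/= -(Sample_LISk_eq1 R mu n k hmu iii).
  rewrite /Sample; apply: le_measure; rewrite ?inE; try exact: measurable_Perm.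
  (* The upper bound on [beta] enters here: [LIS] is at least [n / k], hence at least [beta * n]. *)
  move=> z /= nk; apply: (@le_trans _ _ (k%:R^-1 * n%:R)).
    by rewrite ler_wpM2r.
  by rewrite ler_pdivrMl ?ltr0n// -natrM ler_nat.
have i_iii : assertion_i -> assertion_iii.
  move=> i; have [mu_square _ _] := hmu.
  apply: (LISk_eq1 R mu k (plane_support R mu)).
  - exact: closed_plane_support.
  - by move=> p [].
  (* A chain of [k.+1] points of the support would keep the rate bounded below, against (i). *)
  - apply: no_northwest_chain_k_nondecreasing => s sz srt; apply: contrapT => no.
    have supp_s p : p \in s -> plane_support R mu p.
      by move=> ps; apply: contrapT => np; apply: no; exists p.
    have [a a0 a_le] := Sample_LIS_chain R mu k.+1 s hmu isT sz srt supp_s.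
    pose gap := beta - k.+1%:R^-1.
    have gap0 : 0 < gap by rewrite subr_gt0.
    (* As soon as [n%:R * gap] exceeds 1, the margin of [beta] over [k.+1%:R^-1] absorbs the extra 1
       in the length bound. *)
    have N_large n : (Num.trunc gap^-1 < n)%N -> (n %/ k.+1).+1%:R < beta * n%:R.
      move=> Nn; have : 1 < n%:R * gap.
        rewrite -ltr_pdivrMr// mul1r.
        by apply: lt_le_trans (truncnS_gt _) _; rewrite ler_nat.
      rewrite mulrBr ltrBrDl [n%:R * beta]mulrC; apply: le_lt_trans.
      by rewrite -[(_ %/ _).+1%:R]natr1 lerD2r ler_pdivlMr// -natrM ler_nat leq_divM.
    (* The liminf is at least the real number [ln a], so it cannot be [-oo]. *)
    have : ((ln a)%:E <= -oo)%E.
      rewrite -i; apply: (limn_einf_ge R _ _ (Num.trunc gap^-1).+1) => n Nn.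
      have n0 : (0 < n)%N by exact: leq_trans Nn.
      rewrite (P_law n [set s : 'S_n | (LIS s)%:R < beta * n%:R] n0).
      apply: lne_power_rate => //; apply: le_trans (a_le n) _.
      rewrite /Sample; apply: le_measure; rewrite ?inE; try exact: measurable_Perm.
      by move=> z /= lez; apply: le_lt_trans (N_large n Nn); rewrite ler_nat.
    by [].
  - exact: mu_plane_support.
by split; split => //; [move=> /i_iii/iii_ii|move=> /ii_i/i_iii].
Unshelve. all: by end_near. Qed.
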